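(* Let $n\le m$, let $\Omega\subset\mathbb{R}^n$ be a domain, let $\omega\in\Omega^n(\mathbb{R}^m)$ be a simple $n$-volume form, let $K\ge 1$, let $f\colon\Omega\to\mathbb{R}^m$ be a $K$-quasiregular $\omega$-curve, and let $\varepsilon>0$ and $K'>K$. Then, for each $x\in\Omega$, there exist a neighborhood $D\Subset\Omega$ of $x$, an isometry $L\colon\mathbb{R}^m\to\mathbb{R}^m$, a $K'$-quasiregular map $\hat f\colon D\to\mathbb{R}^n$, and a continuous Sobolev map $h\colon D\to\mathbb{R}^{m-n}$ in $W^{1,n}(D,\mathbb{R}^{m-n})$ for which $L\circ f|_D=(\hat f,h)\colon D\to\mathbb{R}^n\times\mathbb{R}^{m-n}$ and $$\frac{\star f^*\omega}{(1+\varepsilon)K'}\le\|\omega_{f(x)}\|\,J_{\hat f}\le(1+\varepsilon)K\,(\star f^*\omega)$$ almost everywhere in $D$.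
   Context: $\Omega^n(N)$ is the space of smooth differential $n$-forms on a manifold $N$ (not to be confused with the domain $\Omega$). An $n$-volume form on $N$ is a form $\omega\in\Omega^n(N)$ that is closed and non-vanishing (nonzero at every point). It is simple if there are 1-forms $\omega_1,\dots,\omega_n\in\Omega^1(N)$ with $\omega=\omega_1\wedge\cdots\wedge\omega_n$. Its pointwise comass norm at $p$ is $\|\omega_p\|=\|\omega\|(p)=\max\{|\omega_p(v_1,\dots,v_n)|: v_i\in T_pN,\ |v_i|\le 1\}$. For an oriented Riemannian $n$-manifold $M$ and $K\ge1$, a $K$-quasiregular $\omega$-curve is a continuous map $f\colon M\to N$ in $W^{1,n}_{\mathrm{loc}}(M,N)$ satisfying $(\|\omega\|\circ f)\,\|Df\|^n\le K\,(\star f^*\omega)$ almost everywhere on $M$. Here $Df$ is the weak differential, $\|Df\|$ its operator norm, $f^*\omega$ is defined almost everywhere via $Df$, and $\star f^*\omega$ is the function with $f^*\omega=(\star f^*\omega)\,\mathrm{vol}_M$. A continuous map $g\colon D\to\mathbb{R}^n$, $D\subset\mathbb{R}^n$ open, is $K$-quasiregular if $g\in W^{1,n}_{\mathrm{loc}}(D,\mathbb{R}^n)$ and $\|Dg\|^n\le K J_g$ almost everywhere in $D$, where $J_g=\det Dg$ is the Jacobian determinant. $D\Subset\Omega$ means that $D$ has compact closure contained in $\Omega$. Isometries of $\mathbb{R}^m$ are Euclidean isometries, possibly affine and possibly orientation-reversing. *)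

(* Defs.v *)
From HB Require Import structures.
From mathcomp Require Import all_boot all_order all_algebra.
From mathcomp Require Import all_classical all_reals all_analysis.

Set Implicit Arguments.
Unset Strict Implicit.
Unset Printing Implicit Defensive.

Import Order.TTheory GRing.Theory Num.Theory.
Import numFieldNormedType.Exports.

Local Open Scope classical_set_scope.
Local Open Scope ring_scope.

(* Points of R^n are row vectors 'rV[R]_n, and a linear map R^n -> R^m is a
   matrix A : 'M[R]_(n, m) acting by v |-> v *m A, as for the library's
   [jacobian].  The library's norm `|v| on 'rV[R]_n is the sup norm, so it is
   used only through its topology; Euclidean lengths are [enorm] below. *)

Section measurable_rV.
Context (R : realType) (n : nat).

Definition rV_coord (i : 'I_n) (v : 'rV[R]_n) : measurableTypeR R := v ord0 i.

Let rV_set0 : g_sigma_preimage rV_coord set0.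
Proof. exact: sigma_algebra0. Qed.

Let rV_setC A : g_sigma_preimage rV_coord A -> g_sigma_preimage rV_coord (~` A).
Proof. exact: sigma_algebraC. Qed.

Let rV_bigcup (F : _^nat) : (forall i, g_sigma_preimage rV_coord (F i)) ->
  g_sigma_preimage rV_coord (\bigcup_i (F i)).
Proof. exact: sigma_algebra_bigcup. Qed.

(* The sigma-algebra on 'rV[R]_n generated by the coordinates, that is, the
   Borel one. *)
HB.instance Definition _ := @isMeasurable.Build default_measure_display
  'rV[R]_n (g_sigma_preimage rV_coord) rV_set0 rV_setC rV_bigcup.

Lemma measurable_rV_coord (i : 'I_n) : measurable_fun setT (rV_coord i).
Proof.
move=> _ Y mY; rewrite setTI; apply: sub_sigma_algebra => /=.
rewrite -bigcup_seq/=; exists i => /=; first by rewrite mem_index_enum.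
by exists Y => //; rewrite setTI.
Qed.

End measurable_rV.

Lemma measurable_fun_rV_coord (R : realType) (n : nat) d (T : measurableType d)
    (f : T -> 'rV[R]_n) :
  (forall i, measurable_fun setT (@rV_coord R n i \o f)) ->
  measurable_fun setT f.
Proof.
move=> mf.
have sub : g_sigma_preimage (fun i => @rV_coord R n i \o f) `<=` measurable.
  apply: smallest_sub; first exact: sigma_algebra_measurable.
  case: n => [|k] in f mf *; first by rewrite big_ord0.
  rewrite -bigcup_mkord_ord; apply: bigcup_sub => i Ii.
  by move=> A [B mB <-]; exact: mf.
move=> _ A mA; apply: sub.
by rewrite g_sigma_preimage_comp; exists A.
Qed.

Section rV_cons.
Context (R : realType) (n : nat).

Definition rV_cons (p : measurableTypeR R * 'rV[R]_n) : 'rV[R]_n.+1 :=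
  row_mx (const_mx p.1 : 'rV_1) p.2.

Definition rV_uncons (v : 'rV[R]_n.+1) : measurableTypeR R * 'rV[R]_n :=
  (rV_coord ord0 v, \row_j rV_coord (lift ord0 j) v).

Lemma rV_coord_cons0 p : rV_coord ord0 (rV_cons p) = p.1.
Proof.
rewrite /rV_coord mxE; case: splitP => [j _|//].
by rewrite mxE.
Qed.

Lemma rV_coord_consS p i : rV_coord (lift ord0 i) (rV_cons p) = rV_coord i p.2.
Proof.
rewrite /rV_coord mxE; case: splitP => [j|j [ij]]; first by rewrite (ord1 j).
by congr (p.2 _ _); exact/val_inj.
Qed.

Lemma rV_consK : cancel rV_cons rV_uncons.
Proof.
move=> p; rewrite /rV_uncons rV_coord_cons0 [RHS]surjective_pairing.
by congr pair; apply/rowP => j; rewrite mxE rV_coord_consS.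
Qed.

Lemma measurable_rV_cons : measurable_fun setT rV_cons.
Proof.
apply: measurable_fun_rV_coord => i.
case: (unliftP ord0 i) => [j|] ->.
  rewrite (_ : _ \o _ = rV_coord j \o snd); last first.
    by apply/funext => p /=; rewrite rV_coord_consS.
  by apply: measurableT_comp => //; exact: measurable_rV_coord.
rewrite (_ : _ \o _ = fst) //.
by apply/funext => p /=; rewrite rV_coord_cons0.
Qed.

Lemma measurable_rV_uncons : measurable_fun setT rV_uncons.
Proof.
apply: measurable_fun_pair => /=; first exact: measurable_rV_coord.
apply: measurable_fun_rV_coord => i.
rewrite (_ : _ \o _ = rV_coord (lift ord0 i)); first exact: measurable_rV_coord.
by apply/funext => v /=; rewrite {1}/rV_coord mxE.
Qed.

Variable mu : {sigma_finite_measure set 'rV[R]_n -> \bar R}.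

Definition lebesgue_cons : set 'rV[R]_n.+1 -> \bar R :=
  pushforward (lebesgue_measure \x mu)%E rV_cons.

HB.instance Definition _ := Measure.copy lebesgue_cons
  (measure_function_pushforward__canonical__measure_function_Measure
     (lebesgue_measure \x mu)%E measurable_rV_cons).

(* The library also proves this, but its canonical instance for [\x] is
   shadowed by the one for subprobability measures. *)
Let sigma_finite_lebesgue_prod : sigma_finite setT (lebesgue_measure \x mu)%E.
Proof.
have /sigma_finiteP[F [TF ndF Foo]] := sigma_finiteT (@lebesgue_measure R).
have /sigma_finiteP[G [TG ndG Goo]] := sigma_finiteT mu.
exists (fun k => F k `*` G k).
  rewrite -setXTT TF TG predeqE => -[x y]; split.
    move=> [/= [i _ Fix] [j _ Gjy]]; exists (maxn i j) => //; split.
    - by move: x Fix; exact/subsetPset/ndF/leq_maxl.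
    - by move: y Gjy; exact/subsetPset/ndG/leq_maxr.
  by move=> [i _ []/= ? ?]; split; exists i.
move=> k; have [? ?] := Foo k; have [? ?] := Goo k.
split; first exact: measurableX.
by rewrite product_measure1E// lte_mul_pinfty// ge0_fin_numE.
Qed.

Let sigma_finite_lebesgue_cons : sigma_finite setT lebesgue_cons.
Proof.
have [F FT mF] := sigma_finite_lebesgue_prod.
exists (fun k => rV_uncons @^-1` F k).
  by rewrite -preimage_bigcup -FT preimage_setT.
move=> k; have [mFk Fk] := mF k; split.
  by rewrite -[X in measurable X]setTI; exact: measurable_rV_uncons.
rewrite /lebesgue_cons /pushforward -comp_preimage.
by rewrite (_ : _ \o _ = id) ?preimage_id//; apply/funext => p; exact: rV_consK.
Qed.

HB.instance Definition _ := Measure_isSigmaFinite.Build _ _ _ lebesgue_cons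
  sigma_finite_lebesgue_cons.

End rV_cons.

(* R^0 is a point of mass 1, and R^(n+1) = R x R^n. *)
Fixpoint lebesgue_rV (R : realType) (n : nat) :
    {sigma_finite_measure set 'rV[R]_n -> \bar R} :=
  match n with
  | 0 => \d_(0 : 'rV[R]_0)
  | k.+1 => lebesgue_cons (lebesgue_rV R k)
  end.

Lemma lebesgue_rV_box (R : realType) (n : nat)
    (A : 'I_n -> set (measurableTypeR R)) :
  (forall i, measurable (A i)) ->
  lebesgue_rV R n [set v | forall i, A i (rV_coord i v)] =
  (\prod_(i < n) lebesgue_measure (A i))%E.
Proof.
elim: n A => [|n IHn] A mA.
  by rewrite big_ord0 /= diracE mem_set//= => -[].
rewrite big_ord_recl -IHn//= /lebesgue_cons /pushforward -product_measure1E//.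
  congr (product_measure1 _ _ _); apply/seteqP; split => p /=.
    move=> Ap; split; first by have := Ap ord0; rewrite rV_coord_cons0.
    by move=> i /=; have := Ap (lift ord0 i); rewrite rV_coord_consS.
  move=> [A0 AS] i; case: (unliftP ord0 i) => [j|] ->.
    by rewrite rV_coord_consS; exact: AS.
  by rewrite rV_coord_cons0.
rewrite (_ : mkset _ =
    \bigcap_(i in [set: 'I_n]) (rV_coord i @^-1` A (lift ord0 i))); last first.
  by apply/seteqP; split => v Av i; [move=> _; exact: Av|exact: (Av i)].
apply: fin_bigcap_measurable => // i _.
by rewrite -[X in measurable X]setTI; exact: measurable_rV_coord.
Qed.

Section euclidean.
Context (R : realType).

Definition enorm n (v : 'rV[R]_n) : R := Num.sqrt (\sum_i v ord0 i ^+ 2).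

Definition euclidean_isometry n (L : 'rV[R]_n -> 'rV[R]_n) : Prop :=
  forall u v, enorm (L u - L v) = enorm (u - v).

Definition opnorm n m (A : 'M[R]_(n, m)) : R :=
  sup [set enorm (v *m A) | v in [set v : 'rV[R]_n | enorm v <= 1]].

Definition domain n (D : set 'rV[R]_n) : Prop :=
  [/\ open D, connected D & D !=set0].

End euclidean.

Section smooth.
Context (R : realType) (n : nat).

Fixpoint C_k (k : nat) (g : 'rV[R]_n -> R) : Prop :=
  match k with
  | 0 => continuous g
  | k'.+1 => (forall x, differentiable g x) /\ forall v, C_k k' ('D_v g)
  end.

Definition smooth (g : 'rV[R]_n -> R) : Prop := forall k, C_k k g.

Definition test_function (D : set 'rV[R]_n) (phi : 'rV[R]_n -> R) : Prop :=
  [/\ smooth phi, compact (closure [set x | phi x != 0]) &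
      closure [set x | phi x != 0] `<=` D].

End smooth.

Section forms.
Context (R : realType).

(* A k-linear form on R^m is a function of the k x m matrix whose rows are its
   k arguments; linearity in each row is phrased as in the library's
   [determinant_multilinear]. *)
Definition alternating_form k m (a : 'M[R]_(k, m) -> R) : Prop :=
  (forall (A B C : 'M[R]_(k, m)) i b c,
     row i A = b *: row i B + c *: row i C ->
     row' i B = row' i A -> row' i C = row' i A ->
     a A = b * a B + c * a C) /\
  (forall (A : 'M[R]_(k, m)) i j, i != j -> row i A = row j A -> a A = 0).

Definition differential_form k m (w : 'rV[R]_m -> 'M[R]_(k, m) -> R) : Prop :=
  (forall p, alternating_form (w p)) /\ (forall V, smooth (w ^~ V)).

(* dw(v_0, ..., v_k) = \sum_i (-1)^i D_{v_i} (w(v_0, .., omit v_i, .., v_k)) for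
   constant vector fields v_0, ..., v_k. *)
Definition ext_d k m (w : 'rV[R]_m -> 'M[R]_(k, m) -> R)
    (p : 'rV[R]_m) (V : 'M[R]_(k.+1, m)) : R :=
  \sum_(i < k.+1) (-1) ^+ i * 'D_(row i V) (w ^~ (row' i V)) p.

Definition volume_form k m (w : 'rV[R]_m -> 'M[R]_(k, m) -> R) : Prop :=
  [/\ differential_form w,
      forall p V, ext_d w p V = 0 &
      forall p, exists V, w p V != 0].

(* (theta_1 /\ ... /\ theta_k)(v_1, ..., v_k) = det (theta_i(v_j)) *)
Definition wedge1 k m (theta : 'I_k -> 'rV[R]_m -> 'rV[R]_m -> R)
    (p : 'rV[R]_m) (V : 'M[R]_(k, m)) : R :=
  \det (\matrix_(i < k, j < k) theta i p (row j V)).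

Definition simple_form k m (w : 'rV[R]_m -> 'M[R]_(k, m) -> R) : Prop :=
  exists theta : 'I_k -> 'rV[R]_m -> 'rV[R]_m -> R,
    (forall i, differential_form (theta i)) /\ w = wedge1 theta.

Definition comass k m (a : 'M[R]_(k, m) -> R) : R :=
  sup [set `|a V| | V in [set V | forall i, enorm (row i V) <= 1]].

(* [star_pullback w f Df] is the function u with f^*w = u vol on R^n, where
   (f^*w)_x(v_1, ..., v_n) = w_(f x)(Df v_1, ..., Df v_n): since vol takes the
   value 1 on the standard basis, u(x) = (f^*w)_x(e_1, ..., e_n). *)
Definition pullback n k m (w : 'rV[R]_m -> 'M[R]_(k, m) -> R)
    (f : 'rV[R]_n -> 'rV[R]_m) (Df : 'rV[R]_n -> 'M[R]_(n, m))
    (x : 'rV[R]_n) (V : 'M[R]_(k, n)) : R :=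
  w (f x) (V *m Df x).

Definition star_pullback n m (w : 'rV[R]_m -> 'M[R]_(n, m) -> R)
    (f : 'rV[R]_n -> 'rV[R]_m) (Df : 'rV[R]_n -> 'M[R]_(n, m))
    (x : 'rV[R]_n) : R :=
  pullback w f Df x 1%:M.

End forms.

(* A weak differential is determined only almost everywhere.  A Sobolev map f
   is therefore accompanied by a representative Df of its weak differential;
   the entry (i, j) of Df x is the weak partial derivative of f_j along e_i. *)
Section sobolev.
Context (R : realType) (n m : nat).
Notation mu := (lebesgue_rV R n).
Implicit Types (D : set 'rV[R]_n) (p : R).
Implicit Types (f : 'rV[R]_n -> 'rV[R]_m) (Df : 'rV[R]_n -> 'M[R]_(n, m)).

Definition Lp_on D p (g : 'rV[R]_n -> R) : Prop := g \_ D \in Lfun mu p%:E.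

Definition Lp_loc D p (g : 'rV[R]_n -> R) : Prop :=
  forall C, compact C -> C `<=` D -> Lp_on C p g.

Definition weak_differential D f Df : Prop :=
  [/\ forall j, Lp_loc D 1 (fun x => f x ord0 j),
      forall i j, Lp_loc D 1 (fun x => Df x i j) &
      forall phi, test_function D phi -> forall i j,
        \int[mu]_(x in D) (f x ord0 j * 'D_(delta_mx ord0 i) phi x) =
        - \int[mu]_(x in D) (Df x i j * phi x)].

Definition sobolev D p f Df : Prop :=
  [/\ weak_differential D f Df,
      forall j, Lp_on D p (fun x => f x ord0 j) &
      forall i j, Lp_on D p (fun x => Df x i j)].

Definition sobolev_loc D p f Df : Prop :=
  [/\ weak_differential D f Df,
      forall j, Lp_loc D p (fun x => f x ord0 j) &
      forall i j, Lp_loc D p (fun x => Df x i j)].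

Definition quasiregular_curve (w : 'rV[R]_m -> 'M[R]_(n, m) -> R) (K : R)
    D f Df : Prop :=
  [/\ {within D, continuous f}, sobolev_loc D n%:R f Df &
      {ae mu, forall x, D x ->
        comass (w (f x)) * opnorm (Df x) ^+ n <= K * star_pullback w f Df x}].

End sobolev.

Definition quasiregular (R : realType) (n : nat) (K : R) (D : set 'rV[R]_n)
    (g : 'rV[R]_n -> 'rV[R]_n) (Dg : 'rV[R]_n -> 'M[R]_n) : Prop :=
  [/\ {within D, continuous g}, sobolev_loc D n%:R g Dg &
      {ae lebesgue_rV R n, forall x, D x -> opnorm (Dg x) ^+ n <= K * \det (Dg x)}].

(* Main.v *)
Require Import Defs.
From mathcomp Require Import all_boot all_order all_algebra perm.
From mathcomp Require Import all_classical all_reals all_analysis.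
From mathcomp Require Import measurable_realfun.
From mathcomp Require Import ring lra.

Set Implicit Arguments.
Unset Strict Implicit.
Unset Printing Implicit Defensive.

Import Order.TTheory GRing.Theory Num.Theory.
Import numFieldNormedType.Exports.

Local Open Scope classical_set_scope.
Local Open Scope ring_scope.

(** A simple n-form w on R^m is V |-> det (V Theta(p)), where the columns of the
m x n matrix Theta(p) are the components of the 1-forms whose wedge product is w.
Freeze the coefficients at p = f x and write Theta(f x) = N T with N an
m x n block of orthonormal columns and T triangular with nonnegative diagonal
([simple_covector_normal_form]).  Then w_{f x}(V) = c det (V N) with c > 0, and
by Hadamard's inequality c is exactly the comass of w_{f x}
([comass_normal_form]).  Complete N to an orthogonal matrix P and let L be
v |-> v P: the first n coordinates of L o f form the map fhat, whose
differential is Df N, so that the frozen pullback is w_{f x}(Df) =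
||w_{f x}|| J_fhat, and the remaining coordinates form h.

What is left is a perturbation argument.  The values of w_{f y} and w_{f x} on
vectors of length at most s differ by at most s^n times the sum of the
differences of the n x n minors of Theta(f y) and Theta(f x)
([det_mulmx_dist]), and by continuity of f and of the coefficients this sum is
below any delta > 0 when y is near x.  With s = ||Df y||, quasiregularity of the
curve bounds (c - delta) ||Df||^n by K times the pullback of w, so the frozen
pullback agrees with the true one up to a factor close to 1; every
inequality of the theorem has some room (K' > K, eps > 0), which fixes delta
([distortion_tolerance], [distortion_bounds]).

The Sobolev part amounts to the linearity of weak differentials
([weak_differential_mulmx]).  Splitting the integrals requires integrability of
an L^1_loc function times a continuous function with compact support, and in
particular that continuous functions are measurable for the sigma-algebra
generated by the coordinates ([continuous_measurable_rV]). *)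

(** * Orthogonal triangularization and Hadamard's inequality *)

Section orthogonal_triangularization.
Context (R : realType).

Lemma enormE n (v : 'rV[R]_n) : enorm v = Num.sqrt ((v *m v^T) ord0 ord0).
Proof.
by rewrite /enorm mxE; congr Num.sqrt; apply: eq_bigr => i _; rewrite mxE expr2.
Qed.

Lemma enorm_ge0 n (v : 'rV[R]_n) : 0 <= enorm v.
Proof. exact: sqrtr_ge0. Qed.

Lemma enorm0 n : enorm (0 : 'rV[R]_n) = 0.
Proof. by rewrite enormE mul0mx mxE sqrtr0. Qed.

Lemma enorm_orthogonal n m (P : 'M[R]_(n, m)) (v : 'rV[R]_n) :
  P *m P^T = 1%:M -> enorm (v *m P) = enorm v.
Proof.
by move=> PP; rewrite !enormE trmx_mul mulmxA -(mulmxA v) PP mulmx1.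
Qed.

Lemma enorm_sqr n (v : 'rV[R]_n) : enorm v ^+ 2 = \sum_i v ord0 i ^+ 2.
Proof. by rewrite sqr_sqrtr// sumr_ge0// => i _; exact: sqr_ge0. Qed.

Lemma normr_coord_le_enorm n (v : 'rV[R]_n) i : `|v ord0 i| <= enorm v.
Proof.
rewrite -(ler_pXn2r (ltn0Sn 1)) ?nnegrE ?enorm_ge0//.
rewrite enorm_sqr real_normK ?num_real//.
by rewrite (bigD1 i)//= lerDl sumr_ge0// => j _; exact: sqr_ge0.
Qed.

Lemma enorm_delta n (i : 'I_n) : enorm (delta_mx ord0 i : 'rV[R]_n) = 1.
Proof. by rewrite enormE trmx_delta mul_delta_mx mxE !eqxx sqrtr1. Qed.

(** The reflection in the hyperplane orthogonal to u - |u| e_0 exchanges u and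
|u| e_0, two vectors of the same length. *)
Lemma householder m (u : 'cV[R]_m.+1) : exists H : 'M[R]_m.+1,
  H *m H^T = 1%:M /\ H *m u = enorm u^T *: delta_mx ord0 ord0.
Proof.
set a := enorm u^T; pose e : 'cV[R]_m.+1 := delta_mx ord0 ord0.
have uu : u^T *m u = (a ^+ 2)%:M.
  rewrite [LHS]mx11_scalar /a enormE trmxK sqr_sqrtr// mxE sumr_ge0// => i _.
  by rewrite mxE -expr2 sqr_ge0.
have [w0|w0] := eqVneq (u - a *: e) 0.
  exists 1%:M; rewrite trmx1 mulmx1 mul1mx; split=> //.
  by apply/eqP; rewrite -subr_eq0 w0.
set w := u - a *: e in w0.
pose b := u ord0 ord0; pose c := (w^T *m w) ord0 ord0.
have wu : w^T *m u = (a ^+ 2 - a * b)%:M.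
  rewrite /w raddfB /= mulmxBl uu linearZ /= -scalemxAl /e trmx_delta.
  rewrite -rowE raddfB /=; congr (_ - _).
  by rewrite [LHS]mx11_scalar !mxE.
have eu : w^T *m e = (b - a)%:M.
  rewrite /e -colE [LHS]mx11_scalar !mxE !eqxx/= mulr1 //.
have ww : w^T *m w = c%:M by rewrite [LHS]mx11_scalar.
(* Since u and a e_0 have the same length, |w|^2 is twice w . u: this is what
   makes the reflection along w send u to u - w. *)
have cE : c = 2 * (a ^+ 2 - a * b).
  rewrite /c {2}/w mulmxBr wu -scalemxAr eu !mxE eqxx !mulr1n; ring.
have c0 : c != 0.
  apply: contra w0 => /eqP c0; apply/eqP/colP => i; rewrite [RHS]mxE.
  have : \sum_i w i ord0 ^+ 2 = 0.
    apply: etrans c0; rewrite /c [RHS]mxE; apply: eq_bigr => k _.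
    by rewrite [w^T _ _]mxE expr2.
  move/eqP; rewrite psumr_eq0; last by move=> k _; exact: sqr_ge0.
  by move=> /allP/(_ i (mem_index_enum i)); rewrite sqrf_eq0 => /eqP.
exists (1%:M - (2 / c) *: (w *m w^T)).
split.
  have -> : (1%:M - (2 / c) *: (w *m w^T))^T = 1%:M - (2 / c) *: (w *m w^T).
    apply/matrixP => i j; rewrite !mxE eq_sym; congr (_ - _ * _).
    by apply: eq_bigr => k _; rewrite !mxE mulrC.
  set M := w *m w^T; set s := 2 / c.
  have MM : M *m M = c *: M.
    by rewrite /M mulmxA -(mulmxA w) ww mul_mx_scalar scalemxAl.
  rewrite mulmxBl mul1mx mulmxBr mulmx1 -scalemxAl -scalemxAr MM !scalerA.
  rewrite (_ : s * s * c = s + s) ?scalerDl; last by rewrite /s; field.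
  by apply/matrixP => i j; rewrite !mxE; ring.
rewrite mulmxBl mul1mx -scalemxAl -mulmxA wu mul_mx_scalar scalerA.
rewrite (_ : 2 / c * _ = 1); first by rewrite scale1r /w opprB addrC subrK.
by rewrite mulrAC -cE mulfV.
Qed.

(** The QR decomposition, by successive reflections.  Reflecting each column to
the positive multiple of a basis vector makes the diagonal nonnegative, so that
no orientation has to be corrected afterwards. *)
Lemma orthogonal_triangularization m n (B : 'M[R]_(m, n)) : exists Q : 'M[R]_m,
  [/\ Q *m Q^T = 1%:M,
      forall (i : 'I_m) (j : 'I_n), (j < i)%N -> (Q *m B) i j = 0 &
      forall (i : 'I_m) (j : 'I_n), i = j :> nat -> 0 <= (Q *m B) i j].
Proof.
elim: m n B => [|m IH] [|n] B;
  do ?by exists 1%:M; rewrite trmx1 mulmx1; split=> // -[].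
  by exists 1%:M; rewrite trmx1 mulmx1; split=> // ? [].
have [H [HH Hu]] := householder (col ord0 B).
have [Q [QQ Qt Qp]] := IH n (drsubmx (H *m B : 'M[R]_(1 + m, 1 + n))).
pose C : 'M[R]_(1 + m, 1 + n) := H *m B.
pose Q1 : 'M[R]_(1 + m) := block_mx 1%:M 0 0 Q.
have Q1Q : Q1 *m Q1^T = 1%:M.
  rewrite /Q1 tr_block_mx mulmx_block !trmx1 !trmx0 QQ.
  by rewrite !mulmx0 !mul0mx !mulmx1 !addr0 add0r -scalar_mx_block.
pose a := enorm (col ord0 B)^T.
have CE i : C i ord0 = a * (i == ord0)%:R.
  have /colP/(_ i) := Hu; rewrite -/a /C !mxE eqxx andbT => <-.
  by apply: eq_bigr => k _; rewrite !mxE.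
have ulC : ulsubmx C = a%:M.
  apply/matrixP => i j; rewrite !ord1 [RHS]mxE eqxx mulr1n 2![LHS]mxE.
  transitivity (C ord0 ord0); first by congr (C _ _); exact/val_inj.
  by rewrite CE mulr1.
have dlC : dlsubmx C = 0.
  apply/matrixP => i j; rewrite !ord1 [RHS]mxE 2![LHS]mxE.
  transitivity (C (rshift 1 i) ord0); first by congr (C _ _); exact/val_inj.
  by rewrite CE mulr0.
have QB : Q1 *m C = block_mx a%:M (ursubmx C) 0 (Q *m drsubmx C).
  rewrite -[C in LHS]submxK ulC dlC /Q1 mulmx_block.
  by rewrite !mul1mx !mul0mx !mulmx0 !addr0 !add0r.
exists (Q1 *m H).
have -> : Q1 *m H *m B = block_mx a%:M (ursubmx C) 0 (Q *m drsubmx C).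
  by rewrite -mulmxA; exact: QB.
split.
- rewrite trmx_mul -mulmxA (mulmxA H); rewrite [H *m _]HH mul1mx; exact: Q1Q.
- move=> i j; case: (@split_ordP 1 m i) => i' ->;
    case: (@split_ordP 1 n j) => j' -> /=; rewrite ?ord1//.
  + by move=> _; apply: etrans (block_mxEdl _ _ _ _ _ _) _; rewrite mxE.
  + by move=> ij; apply: etrans (block_mxEdr _ _ _ _ _ _) _; exact: Qt.
- move=> i j; case: (@split_ordP 1 m i) => i' ->;
    case: (@split_ordP 1 n j) => j' -> /=; rewrite ?ord1//.
  + move=> _; rewrite [leRHS](block_mxEul a%:M _ _ _ ord0 ord0).
    by rewrite mxE eqxx mulr1n enorm_ge0.
  + by move=> -[] ij; rewrite [leRHS](block_mxEdr a%:M _ _ _ i' j'); exact: Qp.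
Qed.

(** An orthogonal change of basis makes the rows triangular without changing their
lengths, and a diagonal entry is at most the length of its row. *)
Lemma hadamard n (A : 'M[R]_n) : `|\det A| <= \prod_i enorm (row i A).
Proof.
have [Q [QQ Qt _]] := orthogonal_triangularization A^T.
have dQ : `|\det Q| = 1.
  by apply/eqP; rewrite -sqrp_eq1// -normrX expr2 -{2}det_tr -det_mulmx QQ det1 normr1.
have tU : is_trig_mx (A *m Q^T).
  by apply/is_trig_mxP => i j ij; rewrite -[A]trmxK -trmx_mul mxE Qt.
have -> : `|\det A| = `|\det (A *m Q^T)|.
  by rewrite det_mulmx normrM det_tr dQ mulr1.
rewrite det_trig// normr_prod; apply: ler_prod => i _; rewrite normr_ge0/=.
have QtQ : Q^T *m (Q^T)^T = 1%:M by rewrite trmxK; exact: mulmx1C QQ.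
have <- : enorm (row i (A *m Q^T)) = enorm (row i A).
  by rewrite row_mul; exact: enorm_orthogonal.
by have := normr_coord_le_enorm (row i (A *m Q^T)) i; rewrite mxE.
Qed.

End orthogonal_triangularization.

(** * Simple forms, comass and operator norm *)

Section simple_forms.
Context (R : realType).

Lemma alternating_form1_sum m (a : 'rV[R]_m -> R) (v : 'rV[R]_m) :
  alternating_form a -> a v = \sum_j v ord0 j * a (delta_mx ord0 j).
Proof.
move=> [lina _].
have lin (b c : R) (B C : 'rV[R]_m) : a (b *: B + c *: C) = b * a B + c * a C.
  by apply: (lina _ _ _ ord0); [rewrite linearP linearZ|
    apply/matrixP => -[]..].
rewrite {1}(row_sum_delta v); elim: (index_enum _) => [|j r IH].
  by have := lin 0 0 0 0; rewrite !scale0r addr0 !mul0r addr0 !big_nil.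
by rewrite !big_cons -(scale1r (\sum_(_ <- _) _)) lin mul1r IH.
Qed.

Lemma simple_form_det m n (w : 'rV[R]_m -> 'M[R]_(n, m) -> R) :
  simple_form w -> exists Theta : 'rV[R]_m -> 'M[R]_(m, n),
    (forall i j, continuous (fun p => Theta p i j)) /\
    forall p V, w p V = \det (V *m Theta p).
Proof.
move=> [theta [dtheta ->]].
exists (fun p => \matrix_(k, i) theta i p (delta_mx ord0 k)); split.
  move=> k i.
  rewrite (_ : (fun p => _) = theta i ^~ (delta_mx ord0 k)); last first.
    by apply/funext => p; rewrite mxE.
  exact: (dtheta i).2 (delta_mx ord0 k) 0%N.
move=> p V; rewrite /wedge1 -det_tr; congr (\det _).
apply/matrixP => i j; rewrite !mxE (alternating_form1_sum _ ((dtheta j).1 p)).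
by apply: eq_bigr => k _; rewrite !mxE.
Qed.

(** Multilinear expansion of V |-> det (V B) in the entries of V; the coefficients
are its values on tuples of basis vectors. *)
Lemma det_mulmx_sum m n (V : 'M[R]_(n, m)) (B : 'M[R]_(m, n)) :
  \det (V *m B) =
  \sum_(phi : {ffun 'I_n -> 'I_m}) (\prod_i V i (phi i)) * \det (rowsub phi B).
Proof.
rewrite {1}/determinant.
transitivity (\sum_(s : {perm 'I_n}) \sum_(phi : {ffun 'I_n -> 'I_m})
    (-1) ^+ s * (\prod_i (V i (phi i) * B (phi i) (s i)))).
  apply: eq_bigr => s _; rewrite -big_distrr/=; congr (_ * _).
  rewrite -(bigA_distr_bigA (fun i k => V i k * B k (s i))).
  by apply: eq_bigr => i _; rewrite mxE.
rewrite exchange_big; apply: eq_bigr => phi _; rewrite big_distrr/=.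
apply: eq_bigr => s _; rewrite big_split/= mulrCA; congr (_ * (_ * _)).
by apply: eq_bigr => i _; rewrite !mxE.
Qed.

Lemma prod_entries_le m n (V : 'M[R]_(n, m)) (s : R)
    (c : {ffun 'I_n -> 'I_m} -> R) :
  (forall i, enorm (row i V) <= s) ->
  `|\sum_(phi : {ffun 'I_n -> 'I_m}) (\prod_i V i (phi i)) * c phi|
    <= s ^+ n * \sum_phi `|c phi|.
Proof.
move=> Vs; rewrite (le_trans (ler_norm_sum _ _ _))// mulr_sumr ler_sum// => phi _.
rewrite normrM ler_wpM2r// normr_prod -[leRHS](_ : \prod_(i < n) s = _).
  apply: ler_prod => i _; rewrite normr_ge0/= (le_trans _ (Vs i))//.
  by have := normr_coord_le_enorm (row i V) (phi i); rewrite mxE.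
by rewrite prodr_const card_ord.
Qed.

(** The expansion [det_mulmx_sum] makes this a bound for the comass of the
difference of two simple covectors, and it is visibly continuous in B. *)
Definition minor_dist m n (B C : 'M[R]_(m, n)) : R :=
  \sum_(phi : {ffun 'I_n -> 'I_m}) `|\det (rowsub phi B) - \det (rowsub phi C)|.

Lemma det_mulmx_dist m n (V : 'M[R]_(n, m)) (B C : 'M[R]_(m, n)) (s : R) :
  (forall i, enorm (row i V) <= s) ->
  `|\det (V *m B) - \det (V *m C)| <= s ^+ n * minor_dist B C.
Proof.
move=> Vs; rewrite !det_mulmx_sum -sumrB.
under eq_bigr do rewrite -mulrBr.
exact: prod_entries_le.
Qed.

Lemma minor_distC m n (B C : 'M[R]_(m, n)) : minor_dist B C = minor_dist C B.
Proof. by apply: eq_bigr => phi _; rewrite distrC. Qed.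

Lemma comass_det_ub m n (B : 'M[R]_(m, n)) (V : 'M[R]_(n, m)) :
  (forall i, enorm (row i V) <= 1) ->
  `|\det (V *m B)| <= comass (fun V => \det (V *m B)).
Proof.
move=> V1; apply: ub_le_sup; last by exists V.
exists (\sum_(phi : {ffun 'I_n -> 'I_m}) `|\det (rowsub phi B)|) => _ [W W1 <-].
by rewrite det_mulmx_sum (le_trans (prod_entries_le _ W1))// expr1n mul1r.
Qed.

Lemma sum_widen_le n m (le_nm : (n <= m)%N) (F : 'I_m -> R) :
  (forall i, 0 <= F i) -> \sum_i F (widen_ord le_nm i) <= \sum_i F i.
Proof.
move=> F0; rewrite -(big_ord_narrow le_nm).
rewrite [leRHS](bigID (fun i : 'I_m => i < n)%N)/=.
by rewrite lerDl sumr_ge0.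
Qed.

Lemma enorm_mul_colsub n m (le_nm : (n <= m)%N) (P : 'M[R]_m) (v : 'rV[R]_m) :
  P *m P^T = 1%:M -> enorm (v *m colsub (widen_ord le_nm) P) <= enorm v.
Proof.
move=> PP; rewrite -[leRHS](enorm_orthogonal v PP) /enorm ler_wsqrtr//.
apply: le_trans (sum_widen_le le_nm _); last by move=> i; exact: sqr_ge0.
apply: ler_sum => i _; rewrite mxE [in leRHS]mxE.
by under eq_bigr do rewrite mxE.
Qed.

(** The orthogonal triangularization Q B = U gives B = N T, where N consists of the
first n columns of P = Q^T and T of the first n rows of U.  As T has a nonnegative
diagonal, c = det T is nonnegative. *)
Lemma simple_covector_normal_form n m (le_nm : (n <= m)%N) (B : 'M[R]_(m, n)) :
  (exists V, \det (V *m B) != 0) ->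
  exists (P : 'M[R]_m) (c : R), [/\ P *m P^T = 1%:M, 0 < c &
    forall V, \det (V *m B) = c * \det (V *m colsub (widen_ord le_nm) P)].
Proof.
move=> [V0 V0B].
have [Q [QQ Qt Qp]] := orthogonal_triangularization B.
set U := Q *m B in Qt Qp; pose T := rowsub (widen_ord le_nm) U.
have QtQ : Q^T *m Q = 1%:M by exact: mulmx1C QQ.
have BE : B = colsub (widen_ord le_nm) Q^T *m T.
  rewrite -[LHS]mul1mx -QtQ -mulmxA -/U; apply/matrixP => i j; rewrite !mxE.
  (* The rows of U beyond the n-th vanish. *)
  rewrite (bigID (fun k : 'I_m => k < n)%N)/= [X in _ + X]big1 ?addr0; last first.
    by move=> k; rewrite -leqNgt => nk; rewrite Qt ?mulr0// (leq_trans _ nk).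
  by rewrite (big_ord_narrow le_nm); apply: eq_bigr => k _; rewrite !mxE.
have detE V : \det (V *m B) = \det T * \det (V *m colsub (widen_ord le_nm) Q^T).
  by rewrite {1}BE mulmxA det_mulmx mulrC.
have T0 : 0 <= \det T.
  rewrite -det_tr det_trig; last first.
    by apply/is_trig_mxP => i j ij; rewrite 2!mxE Qt.
  by apply: prodr_ge0 => i _; rewrite mxE mxE Qp.
exists Q^T, (\det T); split => //; first by rewrite trmxK.
by rewrite lt_def T0 andbT; apply: contra V0B => /eqP T00; rewrite detE T00 mul0r.
Qed.

(** Hadamard's inequality gives the upper bound; the first n columns of P attain
it. *)
Lemma comass_normal_form n m (le_nm : (n <= m)%N) (P : 'M[R]_m) (c : R) :
  P *m P^T = 1%:M -> 0 <= c ->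
  comass (fun V : 'M[R]_(n, m) => c * \det (V *m colsub (widen_ord le_nm) P)) = c.
Proof.
move=> PP c0; set N := colsub _ P.
have PtP : P^T *m P = 1%:M by exact: mulmx1C.
have NN : N^T *m N = 1%:M.
  apply/matrixP => i j.
  have /matrixP/(_ (widen_ord le_nm i) (widen_ord le_nm j)) := PtP.
  by rewrite !mxE => <-; apply: eq_bigr => k _; rewrite !mxE.
have N1 i : enorm (row i N^T) <= 1.
  have := @enorm_mul_colsub _ _ (leqnn m) P^T
    (delta_mx ord0 (widen_ord le_nm i)).
  rewrite trmxK PtP enorm_delta => /(_ erefl); congr (enorm _ <= _).
  rewrite -rowE; apply/rowP => j; rewrite !mxE; congr (P _ _); exact/val_inj.
have ub : ubound [set `|c * \det (V *m N)| | V in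
    [set V : 'M[R]_(n, m) | forall i, enorm (row i V) <= 1]] c.
  move=> _ [V V1 <-]; rewrite normrM ger0_norm// ler_piMr// (le_trans (hadamard _))//.
  rewrite -[leRHS](_ : \prod_(i < n) 1 = 1); last by rewrite prodr_const expr1n.
  apply: ler_prod => i _; rewrite enorm_ge0 row_mul/=.
  exact: le_trans (enorm_mul_colsub _ _ PP) (V1 i).
apply/eqP; rewrite eq_le; apply/andP; split.
  by apply: ge_sup ub; exists `|c * \det (N^T *m N)|; exists N^T.
apply: ub_le_sup; first by exists c.
by exists N^T => //; rewrite NN det1 mulr1 ger0_norm.
Qed.

(** [opnorm] is a supremum, which is 0 by convention on an unbounded set. *)
Lemma opnorm_has_ub n m (A : 'M[R]_(n, m)) :
  has_ubound [set enorm (v *m A) | v in [set v : 'rV[R]_n | enorm v <= 1]].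
Proof.
exists (Num.sqrt (\sum_j (\sum_i `|A i j|) ^+ 2)) => _ [v v1 <-].
rewrite /enorm ler_wsqrtr// ler_sum// => j _.
rewrite -real_normK ?num_real// lerXn2r ?nnegrE ?sumr_ge0//.
rewrite mxE (le_trans (ler_norm_sum _ _ _))// ler_sum// => i _.
by rewrite normrM ler_piMl// (le_trans (normr_coord_le_enorm _ _)).
Qed.

Lemma enorm_row_le_opnorm n m (A : 'M[R]_(n, m)) i : enorm (row i A) <= opnorm A.
Proof.
apply: ub_le_sup; first exact: opnorm_has_ub.
by exists (delta_mx ord0 i); rewrite ?rowE//= enorm_delta.
Qed.

Lemma opnorm_ge0 n m (A : 'M[R]_(n, m)) : 0 <= opnorm A.
Proof.
apply: le_trans (enorm_ge0 (0 *m A)) _; apply: ub_le_sup; first exact: opnorm_has_ub.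
by exists 0 => //=; rewrite enorm0.
Qed.

Lemma opnorm_le n m p (A : 'M[R]_(n, m)) (B : 'M[R]_(n, p)) :
  (forall v, enorm (v *m A) <= enorm (v *m B)) -> opnorm A <= opnorm B.
Proof.
move=> AB; apply: ge_sup.
  by exists (enorm (0 *m A)), 0 => //=; rewrite enorm0.
move=> _ [v v1 <-]; apply: le_trans (AB v) _.
by apply: ub_le_sup; [exact: opnorm_has_ub|exists v].
Qed.

End simple_forms.

(** * Borel sets and L^p functions on R^n *)

Section measurability_rV.
Context (R : realType) (n : nat).

(** Balls are those of the sup norm, that is, boxes. *)
Lemma measurable_ball_rV (x : 'rV[R]_n) (e : R) : measurable (ball x e).
Proof.
have [e0|e0] := ltP 0 e; last first.
  rewrite (_ : ball x e = set0) //; apply/seteqP; split => // y [].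
  by rewrite ltNge e0.
rewrite (_ : ball x e =
    \bigcap_(i in [set: 'I_n]) (rV_coord i @^-1` (ball (x ord0 i) e))); last first.
  apply/seteqP; split => [y [_ xy] i _|y xy]; first exact: xy.
  by split => // i j; rewrite ord1; exact: xy.
apply: fin_bigcap_measurable => // i _.
have := @measurable_rV_coord R n i measurableT (ball (x ord0 i) e).
by rewrite setTI; apply; apply: open_measurable; exact: ball_open.
Qed.

(** An open set is the union of the countably many boxes contained in it that have
a rational centre and a radius 1/(k+1). *)
Lemma open_measurable_rV (U : set 'rV[R]_n) : open U -> measurable U.
Proof.
move=> oU.
pose F (qk : 'rV[rat]_n * nat) : set 'rV[R]_n :=
  let B := ball (map_mx ratr qk.1 : 'rV[R]_n) (qk.2.+1%:R^-1) in
  if `[< B `<=` U >] then B else set0.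
have -> : U = \bigcup_qk F qk.
  apply/seteqP; split => [x Ux|x [qk _]]; last first.
    by rewrite /F; case: asboolP => // BU; exact: BU.
  have /nbhs_ballP[e /= e0 xeU] := open_nbhs_nbhs (conj oU Ux).
  have [k ke] : exists k : nat, k.+1%:R^-1 < e / 2.
    have [k _ /(_ k (leqnn k))] :=
      near_infty_natSinv_lt (PosNum (divr_gt0 e0 (ltr0Sn R 1))).
    by exists k.
  set d := k.+1%:R^-1 : R in ke; have d0 : 0 < d by rewrite invr_gt0.
  have xd (i : 'I_n) : exists q : rat, `|x ord0 i - ratr q| < d.
    have [q qi] := @rat_in_itvoo R (x ord0 i - d) (x ord0 i + d) ltac:(lra).
    exists q; rewrite ltr_distlC; move: qi; rewrite in_itv /= => /andP[h1 h2].
    by apply/andP; split; lra.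
  have [q qd] := choice xd.
  exists (\row_i q i, k) => //; rewrite /F /= -/d.
  have xB : ball (map_mx ratr (\row_i q i) : 'rV[R]_n) d x.
    split => // i j; rewrite ord1 !mxE; apply: ball_sym; exact: qd.
  case: asboolP => // BU; exfalso; apply: BU => y qy; apply: xeU.
  exact: ball_splitr (le_ball (ltW ke) xB) (le_ball (ltW ke) qy).
apply: countable_bigcupT_measurable => // qk; rewrite /F; case: asboolP => // _.
exact: measurable_ball_rV.
Qed.

Lemma continuous_measurable_rV (phi : 'rV[R]_n -> R) :
  continuous phi -> measurable_fun setT phi.
Proof.
move=> /continuousP cf; apply: (measurability _ (RGenOpens.measurableE R)).
move=> _ [_ [a [b ->] <-]]; rewrite setTI; apply: open_measurable_rV.
exact/cf/interval_open.
Qed.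

End measurability_rV.

Section Lp_rV.
Context (R : realType) (n : nat).
Notation mu := (lebesgue_rV R n).
Implicit Types (C D : set 'rV[R]_n) (g : 'rV[R]_n -> R) (p : R).

Lemma Lp_onS C D p g : 1 <= p -> measurable D -> D `<=` C ->
  Lp_on C p g -> Lp_on D p g.
Proof.
move=> p1 mD DC gC; have ip := Lfun_integrable p1 gC.
move: gC; rewrite /Lp_on inE => /andP[/[!inE]/= mg _].
have gDE : g \_ D = (g \_ C) \_ D.
  apply/funext => x; rewrite /patch; case: ifPn => // /set_mem Dx.
  by rewrite mem_set//; exact: DC.
have mgD : measurable_fun setT (g \_ D).
  by rewrite gDE; apply/(measurable_restrictT _ mD); exact: measurable_funTS.
apply/andP; rewrite !inE/=; split => //.
rewrite /finite_norm unlock /Lnorm poweR_lty//.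
have /integrableP[_] := ip; apply: le_lt_trans.
apply: ge0_le_integral => //=.
- apply/measurable_EFinP; apply: (measurableT_comp (measurable_powR _)).
  exact: measurableT_comp.
- apply/measurable_EFinP; apply: measurableT_comp => //.
  by apply: (measurableT_comp (measurable_powR _)); exact: measurableT_comp.
- move=> x _; rewrite lee_fin [leRHS]ger0_norm ?powR_ge0// gDE.
  apply: (ge0_ler_powR (le_trans ler01 p1)); rewrite ?nnegrE ?normr_ge0//.
  by rewrite /patch; case: ifPn => //; rewrite normr0.
Qed.

Lemma Lp_on_lincomb D p m (g : 'I_m -> 'rV[R]_n -> R) (c : 'I_m -> R) :
  1 <= p -> (forall k, Lp_on D p (g k)) ->
  Lp_on D p (fun x => \sum_k g k x * c k).
Proof.
move=> p1 gL; have p1E : (1 <= p%:E)%E by rewrite lee_fin.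
have [L0 LD] := Lfun_submod_closed mu p1E.
rewrite /Lp_on (_ : _ \_ D = \sum_k c k *: (g k \_ D)).
  by elim/big_rec: _ => // k f _ fL; exact: LD (gL k) fL.
apply/funext => x; rewrite fct_sumE.
rewrite [RHS](eq_bigr (fun k => c k * (g k \_ D) x)) //.
rewrite /patch; case: ifPn => xD; last by rewrite big1// => k _; rewrite mulr0.
by apply: eq_bigr => k _; rewrite mulrC.
Qed.

(** The product is that of psi, which is bounded, and of the restriction of g to C,
which is integrable. *)
Lemma integrable_mul_continuous C g (psi : 'rV[R]_n -> R) :
  compact C -> Lp_on C 1 g -> continuous psi -> (forall x, ~ C x -> psi x = 0) ->
  mu.-integrable setT (EFin \o (fun x => g x * psi x)).
Proof.
move=> cC gC cpsi psi0.
have [M psiM] : exists M, forall x, `|psi x| <= M.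
  have [C0|/nonemptyPn C0] := pselect (C !=set0); last first.
    by exists 0 => x; rewrite psi0 ?normr0 // C0.
  have [|c cC' cM] := @EVT_max_rV R n (fun x => `|psi x|) C C0 cC.
    by apply: continuous_subspaceT => x; exact: cvg_norm (cpsi x).
  exists `|psi c| => x; have [Cx|Cx] := pselect (C x); first exact/cM/mem_set.
  by rewrite psi0// normr0.
have gpsiE x : g x * psi x = (g \_ C) x * psi x.
  rewrite /patch; case: ifPn => // /negP Cx; rewrite psi0 ?mulr0// => Cx'.
  exact/Cx/mem_set.
have /Lfun1_integrable igC := gC.
have mgC : measurable_fun setT (g \_ C).
  by apply/measurable_EFinP; case/integrableP: igC.
apply: (@le_integrable _ _ _ _ _ _ _ (fun x => M%:E * (EFin \o g \_ C) x)%E) => //.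
- apply/measurable_EFinP; under eq_fun do rewrite gpsiE.
  by apply: measurable_funM => //; exact: continuous_measurable_rV.
- move=> x _; rewrite /= lee_fin gpsiE normrM mulrC normrM ler_wpM2r//.
  exact: le_trans (psiM x) (ler_norm _).
- exact: integrableZl.
Qed.

Lemma Rintegral_lincomb D m (u : 'I_m -> 'rV[R]_n -> R) (c : 'I_m -> R) :
  measurable D -> (forall k, mu.-integrable setT (EFin \o u k)) ->
  \int[mu]_(x in D) (\sum_k u k x * c k) = \sum_k (\int[mu]_(x in D) u k x) * c k.
Proof.
move=> mD iu.
have iuD k : mu.-integrable D (EFin \o u k).
  exact: integrableS (iu k).
elim: (index_enum _) => [|k r IH].
  by under eq_Rintegral do rewrite big_nil; rewrite big_nil Rintegral_cst// mul0r.
under eq_Rintegral do rewrite big_cons.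
rewrite big_cons -IH -RintegralZr// RintegralD//.
  rewrite (_ : _ \o _ = fun x => ((c k)%:E * (EFin \o u k) x)%E).
    exact: integrableZl.
  by apply/funext => x; rewrite /= mulrC.
rewrite (_ : _ \o _ = fun x => (\sum_(k <- r) (c k)%:E * (u k x)%:E)%E).
  by apply: integrable_sum => // i _; apply: integrableZl => //; exact: iuD.
apply/funext => x /=; rewrite sumEFin; congr EFin.
by apply: eq_bigr => i _; rewrite mulrC.
Qed.

End Lp_rV.

(** * Sobolev maps followed by a linear map *)

Section sobolev_linear.
Context (R : realType) (n m k : nat).
Notation mu := (lebesgue_rV R n).
Implicit Types (D Omega C : set 'rV[R]_n) (p : R).
Implicit Types (f : 'rV[R]_n -> 'rV[R]_m) (Df : 'rV[R]_n -> 'M[R]_(n, m)).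
Implicit Types (P : 'M[R]_(m, k)).

Lemma derive_outside_support (phi : 'rV[R]_n -> R) (v x : 'rV[R]_n) :
  ~ closure [set y | phi y != 0] x -> 'D_v phi x = 0.
Proof.
move=> Sx; rewrite (@near_eq_derive _ _ _ phi (cst 0) x v) ?derive_cst//.
have : nbhs x (~` closure [set y | phi y != 0]).
  by apply: open_nbhs_nbhs; split => //; exact/closed_openC/closed_closure.
apply: filterS => y Sy; apply/eqP/negPn/negP => phiy.
by apply: Sy; exact: subset_closure.
Qed.

Lemma Lp_loc_mulmx D Omega p l (F : 'rV[R]_n -> 'M[R]_(l, m)) P i :
  1 <= p -> D `<=` Omega ->
  (forall j, Lp_loc Omega p (fun x => F x i j)) ->
  forall j, Lp_loc D p (fun x => (F x *m P) i j).
Proof.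
move=> p1 DO FL j C cC CD; under eq_fun do rewrite mxE.
by apply: Lp_on_lincomb => // q; apply: FL => //; exact: subset_trans DO.
Qed.

(** A test function for D is one for Omega, with the same integrals since phi and
its derivatives vanish outside the support of phi; hence restriction to D costs
nothing, and the linear map commutes with the integrals. *)
Lemma weak_differential_mulmx D Omega f Df P :
  measurable D -> D `<=` Omega -> weak_differential Omega f Df ->
  weak_differential D (fun x => f x *m P) (fun x => Df x *m P).
Proof.
move=> mD DO [f1 Df1 ffDf]; split.
- exact: Lp_loc_mulmx (lexx 1) DO f1.
- by move=> i; exact: Lp_loc_mulmx (lexx 1) DO (Df1 i).
move=> phi [sphi cS SD] i j; set S := closure _ in cS SD.
have SO : S `<=` Omega by exact: subset_trans DO.
have phi0 x : ~ S x -> phi x = 0.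
  by move=> Sx; apply/eqP/negPn/negP => /= phix; apply: Sx; exact: subset_closure.
pose psi := 'D_(delta_mx ord0 i) phi.
have psi0 x : ~ S x -> psi x = 0 by exact: derive_outside_support.
have cphi : continuous phi := sphi 0%N.
have cpsi : continuous psi := (sphi 1%N).2 _.
have int_S (g u : 'rV[R]_n -> R) E : S `<=` E -> (forall x, ~ S x -> u x = 0) ->
    \int[mu]_(x in E) (g x * u x) = \int[mu]_x (g x * u x).
  move=> SE u0; rewrite Rintegral_mkcond; congr (Rintegral mu _ _).
  apply/funext => x; rewrite /patch; case: ifPn => // /negP Ex.
  by rewrite u0 ?mulr0// => Sx; apply: Ex; exact/mem_set/SE.
have -> : \int[mu]_(x in D) ((f x *m P) ord0 j * psi x) =
          \sum_l (\int[mu]_(x in D) (f x ord0 l * psi x)) * P l j.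
  rewrite -Rintegral_lincomb//; last first.
    by move=> l; apply: (integrable_mul_continuous cS) => //; exact: f1.
  apply: eq_Rintegral => x _; rewrite mxE mulr_suml.
  by apply: eq_bigr => l _; rewrite mulrAC.
have -> : \int[mu]_(x in D) ((Df x *m P) i j * phi x) =
          \sum_l (\int[mu]_(x in D) (Df x i l * phi x)) * P l j.
  rewrite -Rintegral_lincomb//; last first.
    by move=> l; apply: (integrable_mul_continuous cS) => //; exact: Df1.
  apply: eq_Rintegral => x _; rewrite mxE mulr_suml.
  by apply: eq_bigr => l _; rewrite mulrAC.
rewrite -sumrN; apply: eq_bigr => l _; rewrite -mulNr; congr (_ * _).
have DOE (g u : 'rV[R]_n -> R) : (forall x, ~ S x -> u x = 0) ->
    \int[mu]_(x in D) (g x * u x) = \int[mu]_(x in Omega) (g x * u x).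
  by move=> u0; rewrite (int_S g u D)// (int_S g u Omega).
have fE := DOE (fun x => f x ord0 l) psi psi0.
have DfE := DOE (fun x => Df x i l) phi phi0.
by rewrite [LHS]fE DfE; exact: ffDf.
Qed.

Lemma sobolev_loc_mulmx D Omega p f Df P : 1 <= p ->
  measurable D -> D `<=` Omega -> sobolev_loc Omega p f Df ->
  sobolev_loc D p (fun x => f x *m P) (fun x => Df x *m P).
Proof.
move=> p1 mD DO [wf fL DfL]; split; first exact: weak_differential_mulmx wf.
- exact: Lp_loc_mulmx p1 DO fL.
- by move=> i; exact: Lp_loc_mulmx p1 DO (DfL i).
Qed.

(** Local integrability becomes integrability on D once D lies in a compact subset
of Omega. *)
Lemma sobolev_mulmx D C Omega p f Df P : 1 <= p ->
  measurable D -> D `<=` C -> compact C -> C `<=` Omega ->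
  sobolev_loc Omega p f Df ->
  sobolev D p (fun x => f x *m P) (fun x => Df x *m P).
Proof.
move=> p1 mD DC cC CO [wf fL DfL]; split.
- by apply: weak_differential_mulmx wf => //; exact: subset_trans CO.
- move=> j; apply: (Lp_onS p1 mD DC).
  exact: (Lp_loc_mulmx P p1 (@subset_refl _ Omega) fL).
- move=> i j; apply: (Lp_onS p1 mD DC).
  exact: (Lp_loc_mulmx P p1 (@subset_refl _ Omega) (DfL i)).
Qed.

Lemma mulmxr_continuous P : continuous (fun v : 'rV[R]_m => v *m P).
Proof.
under eq_fun do rewrite mulmx_sum_row.
apply: (continuous_big (@add_continuous _)) => // i _ v.
apply: (@continuous_comp _ _ _ (fun u : 'rV[R]_m => u 0 i) ( *:%R ^~ (row i P)) v).
  exact: coord_continuous.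
exact: scalel_continuous.
Qed.

Lemma within_continuous_mulmx D f P :
  {within D, continuous f} -> {within D, continuous (fun x => f x *m P)}.
Proof.
move=> cf x.
apply: (@continuous_comp (subspace D) _ _ f (fun v : 'rV[R]_m => v *m P) x).
  exact: cf.
exact: mulmxr_continuous.
Qed.

End sobolev_linear.

(** * Freezing the coefficients *)

Section local_distortion.
Context (R : realType).

Lemma comass_det_le_dist m n (B C : 'M[R]_(m, n)) :
  comass (fun V => \det (V *m B)) <=
  comass (fun V => \det (V *m C)) + minor_dist B C.
Proof.
apply: ge_sup; first by exists `|\det (0 *m B)|, 0 => // i; rewrite row0 enorm0.
move=> _ [V V1 <-]; rewrite -lerBlDr (le_trans _ (comass_det_ub C V1))// lerBlDr.
rewrite addrC -lerBlDr (le_trans (lerB_dist _ _))//.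
by rewrite (le_trans (det_mulmx_dist _ _ V1))// expr1n mul1r.
Qed.

Lemma det_continuous (T : topologicalType) n (A : T -> 'M[R]_n) :
  (forall i j, continuous (fun t => A t i j)) -> continuous (fun t => \det (A t)).
Proof.
move=> cA; apply: (continuous_big (@add_continuous _)) => // s _ t.
apply: cvgMr; apply: (cvg_big (@mul_continuous _)) => // i _.
exact: cA.
Qed.

Lemma minor_dist_continuous (T : topologicalType) m n (A : T -> 'M[R]_(m, n))
    (B : 'M[R]_(m, n)) :
  (forall i j, continuous (fun t => A t i j)) ->
  continuous (fun t => minor_dist (A t) B).
Proof.
move=> cA; apply: (continuous_big (@add_continuous _)) => // phi _ t.
apply: cvg_norm; apply: cvgB; last exact: cvg_cst.
apply: (@det_continuous _ _ (fun t => rowsub phi (A t)) _ t) => i j.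
under eq_fun do rewrite mxE.
exact: cA.
Qed.

Lemma minor_distxx m n (B : 'M[R]_(m, n)) : minor_dist B B = 0.
Proof. by rewrite /minor_dist big1// => phi _; rewrite subrr normr0. Qed.

(** Splitting coordinates by column selection keeps the casts between n + (m - n)
and m away from the matrix P. *)
Lemma row_mx_colsub n m (le_nm : (n <= m)%N) (v : 'rV[R]_m) :
  v = castmx (erefl 1%N, subnKC le_nm)
    (row_mx (colsub (widen_ord le_nm) v)
            (colsub (fun j => cast_ord (subnKC le_nm) (rshift n j)) v)).
Proof.
apply/rowP => j; rewrite castmxE /= cast_ord_id mxE.
case: splitP => l jl; rewrite mxE; congr (v _ _); exact/val_inj.
Qed.

(** The first bound on delta leaves room for the passage from K to K', the second
for the factor 1 + eps. *)
Lemma distortion_tolerance (c K K' eps : R) : 0 < c -> 1 <= K -> K < K' -> 0 < eps ->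
  exists delta, [/\ 0 < delta, delta * (K' * (1 + K)) <= c * (K' - K) &
    delta * (K + eps) <= eps * c].
Proof.
move=> c0 K1 KK e0.
have a0 : 0 < K' * (1 + K) by apply: mulr_gt0; lra.
have b0 : 0 < K + eps by lra.
exists (Num.min (c * (K' - K) / (K' * (1 + K))) (eps * c / (K + eps))); split.
- by rewrite lt_min !divr_gt0 ?mulr_gt0//; lra.
- by rewrite -ler_pdivlMr// ge_min lexx.
- by rewrite -ler_pdivlMr// ge_min lexx orbT.
Qed.

(** In the application C is the comass of w at f y, t = ||Df||^n, S is the pullback
of w and c * J the frozen pullback.  Everything follows from
(c - delta) t <= K S, which turns the error t * delta into a small multiple of S. *)
Lemma distortion_bounds (c K K' eps delta C t S J : R) :
  0 < c -> 1 <= K -> K < K' -> 0 < eps -> 0 < delta ->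
  delta * (K' * (1 + K)) <= c * (K' - K) -> delta * (K + eps) <= eps * c ->
  0 <= t -> c <= C + delta -> C * t <= K * S -> `|S - c * J| <= t * delta ->
  [/\ t <= K' * J, S / ((1 + eps) * K') <= c * J & c * J <= (1 + eps) * K * S].
Proof.
move=> c0 K1 KK e0 d0 dK de t0 cC CtS; rewrite ler_norml => /andP[SJl SJu].
have K0 : 0 < K by lra.
have K'0 : 0 < K' by lra.
have dc : delta < c.
  have cK := mulr_gt0 c0 K0; have dKK := mulr_gt0 d0 (mulr_gt0 K'0 K0).
  by rewrite -(ltr_pM2r K'0); lra.
have ct : (c - delta) * t <= K * S.
  by apply: le_trans CtS; apply: ler_wpM2r => //; lra.
have S0 : 0 <= S by rewrite -(pmulr_rge0 _ K0) (le_trans _ ct)// mulr_ge0//; lra.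
have qK : c * K <= K' * (c - delta - K * delta) by lra.
split.
- rewrite -(ler_pM2l c0) -(ler_pM2l K0).
  have h1 : c * K * t <= K' * (c - delta - K * delta) * t by apply: ler_wpM2r.
  have h2 : K' * (K * (S - t * delta)) <= K' * (K * (c * J)).
    by rewrite !ler_pM2l//; lra.
  have h3 : K' * ((c - delta) * t) <= K' * (K * S) by rewrite ler_pM2l.
  lra.
- have h : S <= K' * (c * J).
    have cd : 0 < c - delta by lra.
    rewrite -(ler_pM2l cd).
    have h1 : delta * ((c - delta) * t) <= delta * (K * S) by rewrite ler_pM2l.
    have h2 : (c - delta) * (S - t * delta) <= (c - delta) * (c * J).
      by rewrite ler_pM2l//; lra.
    have h3 : K' * ((c - delta) * (S - t * delta)) <= K' * ((c - delta) * (c * J)).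
      by rewrite ler_pM2l.
    have h4 : c * K * S <= K' * (c - delta - K * delta) * S by apply: ler_wpM2r.
    have h5 : K' * (delta * ((c - delta) * t)) <= K' * (delta * (K * S)).
      by rewrite ler_pM2l.
    have h6 : (c - delta) * S <= c * K * S by apply: ler_wpM2r => //; nra.
    lra.
  rewrite ler_pdivrMr; last by rewrite mulr_gt0//; lra.
  have cJ0 : 0 <= K' * (c * J) by exact: le_trans S0 h.
  have := mulr_ge0 (ltW e0) cJ0; lra.
- have cd : 0 < c - delta by lra.
  have h1 : delta * ((c - delta) * t) <= delta * (K * S) by rewrite ler_pM2l.
  have h2 : delta * K * S <= eps * (c - delta) * S by apply: ler_wpM2r => //; lra.
  have h3 : (c - delta) * (t * delta) <= (c - delta) * (eps * S) by lra.
  rewrite ler_pM2l// in h3.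
  have h4 : (1 + eps) * S * 1 <= (1 + eps) * S * K.
    by apply: ler_wpM2l => //; apply: mulr_ge0 => //; lra.
  lra.
Qed.

End local_distortion.

Theorem theorem1p10 (R : realType) (n m : nat)
    (n_gt0 : (0 < n)%N) (le_nm : (n <= m)%N)
    (Omega : set 'rV[R]_n) (w : 'rV[R]_m -> 'M[R]_(n, m) -> R) (K : R)
    (f : 'rV[R]_n -> 'rV[R]_m) (Df : 'rV[R]_n -> 'M[R]_(n, m))
    (eps K' : R) :
  domain Omega ->
  volume_form w -> simple_form w ->
  1 <= K -> quasiregular_curve w K Omega f Df ->
  0 < eps -> K < K' ->
  forall x, Omega x ->
  exists (D : set 'rV[R]_n) (L : 'rV[R]_m -> 'rV[R]_m)
    (fhat : 'rV[R]_n -> 'rV[R]_n) (Dfhat : 'rV[R]_n -> 'M[R]_n)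
    (h : 'rV[R]_n -> 'rV[R]_(m - n)) (Dh : 'rV[R]_n -> 'M[R]_(n, m - n)),
  [/\ [/\ open D, D x, compact (closure D) & closure D `<=` Omega],
      euclidean_isometry L,
      quasiregular K' D fhat Dfhat,
      {within D, continuous h} /\ sobolev D n%:R h Dh &
      (forall y, D y ->
         L (f y) = castmx (erefl 1%N, subnKC le_nm) (row_mx (fhat y) (h y))) /\
      {ae lebesgue_rV R n, forall y, D y ->
         star_pullback w f Df y / ((1 + eps) * K')
           <= comass (w (f x)) * \det (Dfhat y)
         /\ comass (w (f x)) * \det (Dfhat y)
           <= (1 + eps) * K * star_pullback w f Df y}].
Proof.
move=> [oO _ _] [_ _ w_neq0] /simple_form_det[A [cA wE]] K1.
move=> [cf sf qrf] eps0 KK' x Ox.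
have wfE p : w p = fun V => \det (V *m A p) by apply/funext => V; rewrite wE.
have [V0 wV0] := w_neq0 (f x).
have [|P [c [PP c0 detE]]] :=
    @simple_covector_normal_form _ _ _ le_nm (A (f x)).
  by exists V0; rewrite -wE.
have comass_x : comass (w (f x)) = c.
  rewrite wfE (_ : (fun V => _) =
      fun V => c * \det (V *m colsub (widen_ord le_nm) P)); last exact/funext.
  exact: comass_normal_form (ltW c0).
have [delta [d0 dK de]] := distortion_tolerance c0 K1 KK' eps0.
have cfx : {for x, continuous f}.
  by move: cf; rewrite continuous_open_subspace// => /(_ x (mem_set Ox)).
have near_x : nbhs x
    (Omega `&` [set y | minor_dist (A (f y)) (A (f x)) < delta]).
  apply: filterI; first exact: open_nbhs_nbhs.
  have : minor_dist (A (f y)) (A (f x)) @[y --> x] --> 0.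
    rewrite -(minor_distxx (A (f x))).
    apply: (@continuous_comp _ _ _ f (fun p => minor_dist (A p) _)) => //.
    exact: minor_dist_continuous.
  by move=> /cvgr_lt; apply.
have [r rU] := (nbhs_closedballP _ _).1 near_x.
set D := ball x r%:num; set N1 := colsub (widen_ord le_nm) P.
pose N2 := colsub (fun j : 'I_(m - n) => cast_ord (subnKC le_nm) (rshift n j)) P.
have clD : closure D = closed_ball x r%:num by rewrite closure_ballE.
have clDO : closure D `<=` Omega by rewrite clD => y /rU [].
have subD : D `<=` closure D by exact: subset_closure.
have DO : D `<=` Omega by exact: subset_trans clDO.
have cD : compact (closure D).
  apply: bounded_closed_compact; last exact: closed_closure.
  exists (`|x| + r%:num); split; first exact: num_real.
  move=> M rM y; rewrite clD closed_ballE// /closed_ball_ /= => xy.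
  by rewrite (le_trans _ (ltW rM))// -lerBlDl (le_trans (lerB_dist _ _))// distrC.
have mD : measurable D by exact: measurable_ball_rV.
have n1 : 1 <= n%:R :> R by rewrite ler1n.
have bounds : {ae lebesgue_rV R n, forall y, D y ->
    [/\ opnorm (Df y *m N1) ^+ n <= K' * \det (Df y *m N1),
      star_pullback w f Df y / ((1 + eps) * K') <= c * \det (Df y *m N1) &
      c * \det (Df y *m N1) <= (1 + eps) * K * star_pullback w f Df y]}.
  apply: filterS qrf => y qry Dy; have {qry} := qry (DO _ Dy).
  rewrite /star_pullback /pullback mul1mx => qry.
  have [_ /= /ltW dy] := rU y (ltac:(by rewrite -clD; exact: subD)).
  have t0 : 0 <= opnorm (Df y) ^+ n by rewrite exprn_ge0// opnorm_ge0.
  have cC : c <= comass (w (f y)) + delta.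
    rewrite -comass_x !wfE (le_trans (comass_det_le_dist _ (A (f y))))//.
    by rewrite lerD2l minor_distC.
  have SJ : `|w (f y) (Df y) - c * \det (Df y *m N1)| <=
      opnorm (Df y) ^+ n * delta.
    rewrite wE -detE.
    rewrite (le_trans (det_mulmx_dist _ _ (enorm_row_le_opnorm _)))//.
    by rewrite ler_wpM2l.
  have [tJ Jl Ju] := distortion_bounds c0 K1 KK' eps0 d0 dK de t0 cC qry SJ.
  split => //; apply: le_trans tJ; rewrite lerXn2r ?nnegrE ?opnorm_ge0//.
  apply: opnorm_le => v; rewrite mulmxA; exact: enorm_mul_colsub.
exists D, (fun v => v *m P), (fun y => f y *m N1), (fun y => Df y *m N1),
  (fun y => f y *m N2), (fun y => Df y *m N2); split.
- by split => //; exact: ball_open.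
- by move=> u v; rewrite -mulmxBl enorm_orthogonal.
- split.
  + apply: within_continuous_mulmx; exact: continuous_subspaceW cf.
  + exact: sobolev_loc_mulmx sf.
  + by apply: filterS bounds => y By Dy; case: (By Dy).
- split; first by apply: within_continuous_mulmx; exact: continuous_subspaceW cf.
  exact: sobolev_mulmx cD clDO sf.
- split; last by rewrite comass_x; apply: filterS bounds => y By Dy; case: (By Dy).
  move=> y _; by rewrite [LHS](row_mx_colsub le_nm) -!mulmx_colsub.
Qed.
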